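(* There exists an efficient (polynomial-time) separation algorithm for the facet defining inequalities of $conv(S)$: given $n$, $r>0$ and a point $(\bar x,\bar y)\in\mathbb{R}^n_+\times\mathbb{R}^n_+$, the algorithm decides whether $(\bar x,\bar y)\in conv(S)$ and, if $(\bar x,\bar y)\notin conv(S)$, it outputs $(k_1,\dots,k_n)\in\{1,2,3,\dots\}^n$ such that the inequality $$\sum_{i=1}^n\big(a_{k_i}x_i+b_{k_i}y_i\big)\ge 1,$$ which is valid for $conv(S)$, is violated by $(\bar x,\bar y)$.
   Context: Let $n\ge1$, $r>0$ and $$S=\Big\{(x,y)\in\mathbb{Z}^n_+\times\mathbb{R}^n_+ : \sum_{i=1}^n x_iy_i\ge r\Big\},$$ where $\mathbb{R}_+=[0,\infty)$ and $\mathbb{Z}_+=\mathbb{Z}\cap[0,\infty)$; $conv$ denotes convex hull. For each positive integer $k$ set $a_k=\frac{1}{2k-1}$ and $b_k=\frac{k(k-1)}{r(2k-1)}$. The (countably many) inequalities $\sum_{i=1}^n(a_{k_i}x_i+b_{k_i}y_i)\ge1$ with $k_1,\dots,k_n$ positive integers are what the paper calls the facet defining inequalities of $conv(S)$. For the running time, the data $r,\bar x,\bar y$ are taken to be rational and time is measured in the encoding length of the input. *)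

(* Defs.v *)
From HB Require Import structures.
From mathcomp Require Import all_boot all_order all_algebra.
From mathcomp Require Import boolp classical_sets reals convex.

Set Implicit Arguments.
Unset Strict Implicit.
Unset Printing Implicit Defensive.

Import Order.TTheory GRing.Theory Num.Theory.

Local Open Scope classical_set_scope.
Local Open Scope ring_scope.

Definition conv_hull (R : realType) (V : lmodType R) (A : set V) : set V :=
  smallest (fun C : set V => convex_set C) A.

Definition mixed_set (R : realType) (n : nat) (r : R) :
    set ('rV[R]_n * 'rV[R]_n)%type :=
  [set p : 'rV[R]_n * 'rV[R]_n | [/\ forall i, p.1 0 i \is a Num.nat,
               forall i, 0 <= p.2 0 i
             & r <= \sum_(i < n) p.1 0 i * p.2 0 i]].

Definition coef_a (R : realType) (k : nat) : R := (2 * k%:R - 1)^-1.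

Definition coef_b (R : realType) (r : R) (k : nat) : R :=
  (k%:R * (k%:R - 1)) / (r * (2 * k%:R - 1)).

Definition facet_ineq (R : realType) (n : nat) (r : R) (k : 'I_n -> nat)
    (p : 'rV[R]_n * 'rV[R]_n) : Prop :=
  1 <= \sum_(i < n) (coef_a R (k i) * p.1 0 i + coef_b r (k i) * p.2 0 i).

(** Polynomial time is measured on a random access machine over natural
    numbers of unbounded size, with structured control instead of jumps, under
    the logarithmic cost criterion: every elementary operation is charged the
    number of bits of all the numbers (addresses included) it handles.  This
    model and multitape Turing machines simulate each other with polynomial
    overhead. *)

Local Open Scope nat_scope.

Definition bitlen (v : nat) : nat := (trunc_log 2 v).+1.

Definition memory := nat -> nat.

Inductive binop := Add | Sub | Mul | Div.

Inductive expr :=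
  | Const of nat
  | Cell of expr
  | Bin of binop & expr & expr.

(** [Assign a e] writes the value of [e] into the cell whose address is the
    value of [a]; a test succeeds when its value is nonzero. *)
Inductive cmd :=
  | Skip
  | Assign of expr & expr
  | Seq of cmd & cmd
  | If of expr & cmd & cmd
  | While of expr & cmd.

Definition binop_val (o : binop) : nat -> nat -> nat :=
  match o with Add => addn | Sub => subn | Mul => muln | Div => divn end.

Fixpoint eval (m : memory) (e : expr) : nat :=
  match e with
  | Const c => c
  | Cell a => m (eval m a)
  | Bin o e1 e2 => binop_val o (eval m e1) (eval m e2)
  end.

Fixpoint expr_cost (m : memory) (e : expr) : nat :=
  match e with
  | Const c => bitlen c
  | Cell a => expr_cost m a + bitlen (eval m a) + bitlen (m (eval m a))
  | Bin _ e1 e2 =>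
      expr_cost m e1 + expr_cost m e2
      + bitlen (eval m e1) + bitlen (eval m e2)
  end.

Definition update (m : memory) (a v : nat) : memory := [eta m with a |-> v].

(** [exec c m t m']: started in [m], [c] halts in [m'] after time [t]. *)
Inductive exec : cmd -> memory -> nat -> memory -> Prop :=
  | ExecSkip m : exec Skip m 1 m
  | ExecAssign m a e :
      exec (Assign a e) m
        (expr_cost m a + expr_cost m e
         + bitlen (eval m a) + bitlen (eval m e))
        (update m (eval m a) (eval m e))
  | ExecSeq c1 c2 m1 m2 m3 t1 t2 :
      exec c1 m1 t1 m2 -> exec c2 m2 t2 m3 ->
      exec (Seq c1 c2) m1 (t1 + t2) m3
  | ExecIfTrue e c1 c2 m m' t :
      eval m e != 0 -> exec c1 m t m' ->
      exec (If e c1 c2) m (expr_cost m e + bitlen (eval m e) + t) m'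
  | ExecIfFalse e c1 c2 m m' t :
      eval m e = 0 -> exec c2 m t m' ->
      exec (If e c1 c2) m (expr_cost m e + bitlen (eval m e) + t) m'
  | ExecWhileTrue e c m1 m2 m3 t1 t2 :
      eval m1 e != 0 -> exec c m1 t1 m2 -> exec (While e c) m2 t2 m3 ->
      exec (While e c) m1 (expr_cost m1 e + bitlen (eval m1 e) + t1 + t2) m3
  | ExecWhileFalse e c m :
      eval m e = 0 ->
      exec (While e c) m (expr_cost m e + bitlen (eval m e)) m.

Definition input_memory (w : seq nat) : memory := nth 0 w.

(** Binary encoding length; at least [size w], as each [bitlen v] is positive. *)
Definition encoding_length (w : seq nat) : nat := \sum_(v <- w) bitlen v.

(** Faithful on nonnegative rationals only: the sign is dropped. *)
Definition rat_code (q : rat) : seq nat := [:: `|numq q|%N; `|denq q|%N].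

Definition instance_code (n : nat) (r : rat) (x y : 'rV[rat]_n) : seq nat :=
  n :: rat_code r ++ flatten [seq rat_code (x ord0 i) | i <- enum 'I_n]
                  ++ flatten [seq rat_code (y ord0 i) | i <- enum 'I_n].

Definition rat_point (R : realType) (n : nat) (x y : 'rV[rat]_n) :
    'rV[R]_n * 'rV[R]_n :=
  (map_mx ratr x, map_mx ratr y).

(** The answer is read off the final memory: cell [0] holds [1] for membership
    in the convex hull and [0] otherwise; in the latter case cells
    [1], ..., [n] hold the indices of a valid and violated inequality. *)
Definition separation_answer (R : realType) (n : nat) (r : rat)
    (x y : 'rV[rat]_n) (m : memory) : Prop :=
  let P : set ('rV[R]_n * 'rV[R]_n)%type := conv_hull (@mixed_set R n (ratr r)) in
  let k (i : 'I_n) : nat := m i.+1 in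
  (m 0 = 1 /\ P (rat_point R x y)) \/
  [/\ m 0 = 0, ~ P (rat_point R x y),
      forall i, 0 < k i,
      forall p, P p -> facet_ineq (ratr r) k p
    & ~ facet_ineq (ratr r) k (rat_point R x y)].

(* Main.v *)
Require Import Defs.
From mathcomp Require Import all_boot all_order all_algebra.
From mathcomp Require Import boolp classical_sets reals convex.
From mathcomp Require Import interval_inference zify ring lra.

Set Implicit Arguments.
Unset Strict Implicit.
Unset Printing Implicit Defensive.

Import Order.TTheory GRing.Theory Num.Theory.

(** Write [H] for the convex hull of the mixed-integer set and, for a pair of
    nonnegative reals, [g_k (x, y) = a_k x + b_k y].

    Every inequality is valid on [H]: for a natural number [x] one has
    [(x - k) (x - k + 1) >= 0], which gives [g_k (x, y) >= min (1, x y / r)],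
    and these minima sum to at least [1] when the [x_i y_i] sum to at least [r]
    ([facet_term_ge_min], [facet_valid]).

    The separation problem decouples over the coordinates, since the left-hand
    side is smallest when every [g_k (x_i, y_i)] is minimal in [k].  Comparing
    [g_k] with [g_(k+1)] shows that for [y > 0] a minimizer is the least
    [k >= 1] with [x r <= k^2 y].  For this [k] the point [(x, y) / g_k (x, y)]
    lies on the segment from [(k - 1, r / (k - 1))] to [(k, r / k)], so it is in
    the hull of the one-coordinate set ([embed_gauge]); when [y = 0] the infimum
    over [k] is [0] and is not attained unless [x = 0].  As [H] is closed under
    adding nonnegative vectors ([hull_upward]), a point whose minimal terms over
    the coordinates with [y_i > 0] sum to at least [1] is a convex combination
    of points of [H] ([hull_of_terms]).  Otherwise that sum is a fraction
    [N / D < 1], hence at most [1 - 1 / D], and indices so large that the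
    coordinates with [y_i = 0] contribute at most [1 / (2 D)] altogether give a
    violated inequality ([violated_of_small_sum]).

    The algorithm finds each minimizer by bisection, in a number of rounds
    linear in the length of the numbers involved, and adds up the terms as exact
    fractions [N / D] ([prog_separate]).  All numbers that occur have
    [O(L^2)] bits, where [L] is the encoding length.  The running time is
    counted in elementary steps, each of which costs at most a constant times
    the largest bit length in memory ([half_cost]); there are [O(L^2)] steps
    ([runs_separate]), whence the bound [O(L^4)]. *)

(** * Convex hulls *)

Section ConvexHull.
Local Open Scope classical_set_scope.
Local Open Scope ring_scope.
Variables (R : realType) (V : lmodType R).
Implicit Types (A C : set V) (p q : V) (t : R).

(** Convexity with the weight as a bounded real number instead of an element of
    the unit interval type. *)
Definition convex_closed C :=
  forall p q t, 0 <= t <= 1 -> C p -> C q -> C (t *: p + (1 - t) *: q).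

Lemma convex_closedP C : convex_closed C <-> convex_set C.
Proof.
split=> [cC p q t /set_mem Cp /set_mem Cq|cC p q t /andP[t0 t1] Cp Cq].
  by apply/mem_set/cC => //; rewrite ge0 le1.
by have /set_mem := cC _ _ (Itv01 t0 t1) (mem_set Cp) (mem_set Cq).
Qed.

Lemma conv_hull_convex A : convex_closed (conv_hull A).
Proof.
move=> p q t t01 Hp Hq C [cC AC].
by have := (convex_closedP C).2 cC p q t t01; apply; [apply: Hp|apply: Hq].
Qed.

Lemma conv_hull_sub A C : convex_closed C -> A `<=` C -> conv_hull A `<=` C.
Proof. by move=> /convex_closedP cC AC p; apply. Qed.

Lemma sub_conv_hull A : A `<=` conv_hull A.
Proof. exact: sub_gen_smallest. Qed.

End ConvexHull.

(** * Geometry of the mixed-integer set *)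

Section MixedSet.
Local Open Scope classical_set_scope.
Local Open Scope ring_scope.
Variables (R : realType) (n : nat) (r : R).
Hypothesis r_gt0 : 0 < r.
Local Notation V := ('rV[R]_n * 'rV[R]_n)%type.
Implicit Types (p q : V) (t : R) (i : 'I_n).
Local Notation S := (@mixed_set R n r).
Local Notation H := (conv_hull S).

Definition nonneg p := (forall i, 0 <= p.1 0 i) /\ (forall i, 0 <= p.2 0 i).

(** The expression is [(x - k) (x - k + 1)], and no natural number lies strictly
    between [k - 1] and [k]. *)
Lemma index_product_ge0 (x : R) (k : nat) : x \is a Num.nat -> (0 < k)%N ->
  0 <= x * x + k%:R * (k%:R - 1) - (2 * k%:R - 1) * x.
Proof.
move=> /natrP[m ->] k0.
have -> : m%:R * m%:R + k%:R * (k%:R - 1) - (2 * k%:R - 1) * m%:R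
  = (m%:R - k%:R) * (m%:R - k%:R + 1) :> R by ring.
have [km|mk] := leqP k m.
  have : k%:R <= m%:R :> R by rewrite ler_nat.
  nra.
have : m%:R + 1 <= k%:R :> R by rewrite natr1 ler_nat.
nra.
Qed.

Lemma double_pred_gt0 (k : nat) : (0 < k)%N -> 0 < 2 * k%:R - 1 :> R.
Proof.
move=> k0; have : 1 <= k%:R :> R by rewrite ler1n.
lra.
Qed.

Lemma facet_termE (k : nat) (x y : R) : (0 < k)%N ->
  coef_a R k * x + coef_b r k * y
  = (r * x + k%:R * (k%:R - 1) * y) / (r * (2 * k%:R - 1)).
Proof.
move=> /double_pred_gt0 k0; rewrite /coef_a /coef_b.
by field; rewrite !gt_eqF.
Qed.

Lemma facet_term_ge0 (k : nat) (x y : R) : (0 < k)%N -> 0 <= x -> 0 <= y ->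
  0 <= coef_a R k * x + coef_b r k * y.
Proof.
move=> k0 x0 y0; rewrite facet_termE// divr_ge0//.
  have : 1 <= k%:R :> R by rewrite ler1n.
  by move=> k1; rewrite addr_ge0 ?mulr_ge0 ?subr_ge0// ?ler0n// ltW.
by rewrite ltW// mulr_gt0// double_pred_gt0.
Qed.

(** With [t = x y / r], multiplying by [(2 k - 1) x] turns the claim into
    [x^2 + k (k - 1) t >= (2 k - 1) x min (1, t)]; this follows from
    [index_product_ge0], after scaling that inequality by [t] when [t < 1]. *)
Lemma facet_term_ge_min (k : nat) (x y : R) :
    x \is a Num.nat -> (0 < k)%N -> 0 <= y ->
  Num.min 1 (x * y / r) <= coef_a R k * x + coef_b r k * y.
Proof.
move=> xnat k0 y0; have x0 := natr_ge0 xnat.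
have [->|xN0] := eqVneq x 0.
  by rewrite mul0r mul0r ge_min facet_term_ge0 ?orbT.
have {xN0} x_gt0 : 0 < x by rewrite lt_def xN0.
have k1 : 1 <= k%:R :> R by rewrite ler1n.
have := index_product_ge0 xnat k0; rewrite facet_termE//.
set K : R := k%:R in k1 *; move=> prod_ge0.
have t0 : 0 <= x * y / r by rewrite divr_ge0 ?mulr_ge0// ltW.
have yE : y = r * (x * y / r) / x by field; rewrite (gt_eqF r_gt0) (gt_eqF x_gt0).
set t := x * y / r in t0 yE *.
have -> : (r * x + K * (K - 1) * y) / (r * (2 * K - 1)) =
   (x * x + K * (K - 1) * t) / ((2 * K - 1) * x).
  rewrite yE; field; rewrite !gt_eqF//; lra.
rewrite ler_pdivlMr ?mulr_gt0//; last lra.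
rewrite /Num.min; case: ltP => [t1|t1].
  have := mulr_ge0 (ltW x_gt0) (ltW x_gt0).
  have : 0 <= K * (K - 1) by rewrite mulr_ge0; lra.
  nra.
have := mulr_ge0 (ltW x_gt0) (ltW x_gt0).
nra.
Qed.

(** Half-spaces are convex, so points of the generating set suffice.  For these,
    either some [x_i y_i / r] is at least [1] and one term alone reaches [1], or
    the lower bounds [x_i y_i / r] of the terms sum to at least [1]. *)
Lemma facet_valid (k : 'I_n -> nat) p :
  (forall i, (0 < k i)%N) -> H p -> facet_ineq r k p.
Proof.
move=> k0; apply: conv_hull_sub => {p} [p q t t01|p [xnat y0 xy]].
  rewrite /facet_ineq => p1 q1.
  pose F (v : V) := \sum_(i < n) (coef_a R (k i) * v.1 0 i + coef_b r (k i) * v.2 0 i).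
  have -> : \sum_(i < n) (coef_a R (k i) * (t *: p + (1 - t) *: q).1 0 i +
      coef_b r (k i) * (t *: p + (1 - t) *: q).2 0 i) = t * F p + (1 - t) * F q.
    rewrite /F !mulr_sumr -big_split/=; apply: eq_bigr => i _.
    by rewrite !mxE; ring.
  rewrite -/(F p) -/(F q) in p1 q1; nra.
rewrite /facet_ineq; pose t i := p.1 0 i * p.2 0 i / r.
have term_ge0 i : 0 <= coef_a R (k i) * p.1 0 i + coef_b r (k i) * p.2 0 i.
  by rewrite facet_term_ge0// natr_ge0.
have [/existsP[i ti1]|/existsPn t1] := boolP [exists i, 1 <= t i].
  rewrite (bigD1 i)//= ler_wpDr ?sumr_ge0//.
  apply: le_trans (facet_term_ge_min (xnat i) (k0 i) (y0 i)).
  by rewrite le_min lexx.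
have : 1 <= \sum_i t i by rewrite -mulr_suml ler_pdivlMr ?mul1r.
move=> /le_trans; apply; apply: ler_sum => i _.
apply: le_trans (facet_term_ge_min (xnat i) (k0 i) (y0 i)).
by rewrite le_min lexx andbT ltW// ltNge t1.
Qed.

(** The translate of the hull is convex, so it is enough to move the points of
    the generating set. *)
Lemma hull_translate p q : (forall p', S p' -> H (p' + q)) -> H p -> H (p + q).
Proof.
move=> Sq; apply: (@conv_hull_sub _ _ S (fun p => H (p + q))) => // {}p p' t t01 Hp Hp'.
have -> : t *: p + (1 - t) *: p' + q = t *: (p + q) + (1 - t) *: (p' + q).
  rewrite !scalerDr addrACA -scalerDl.
  by rewrite [t + _]addrC subrK scale1r.
exact: conv_hull_convex.
Qed.

Definition ray i (u : R) : V := (u *: delta_mx 0 i, 0).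

(** Integrality forbids moving a point of the set itself by a fraction of
    [e_i], but the point moved by [u] lies between the points moved by the two
    integers next to [u]. *)
Lemma hull_add_ray i u p : 0 <= u -> H p -> H (p + ray i u).
Proof.
move=> u0; apply: hull_translate => {}p [xnat y0 xy].
have Sp (m : nat) : S (p + ray i m%:R).
  split=> [j|j|].
  - by rewrite !mxE rpredD// rpredM// ?rpred_nat.
  - by rewrite !mxE addr0.
  - apply: le_trans xy _; apply: ler_sum => j _; rewrite !mxE addr0.
    by rewrite ler_wpM2r// lerDl mulr_ge0 ?ler0n.
have um : (Num.truncn u)%:R <= u <= (Num.truncn u)%:R + 1.
  by have /andP[-> /ltW] := truncn_itv u0; rewrite natr1.
set m := Num.truncn u in um.
have -> : p + ray i u = (1 - (u - m%:R)) *: (p + ray i m%:R) +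
    (1 - (1 - (u - m%:R))) *: (p + ray i (m.+1)%:R).
  rewrite !scalerDr addrACA -scalerDl [(1 - _) + _]addrC subrK scale1r.
  congr (_ + _); rewrite /ray; congr pair; last first.
    by rewrite /= !scaler0 addr0.
  rewrite /= !scalerA -scalerDl -natr1; congr (_ *: _); ring.
by apply: conv_hull_convex; [lra | exact: sub_conv_hull (Sp _)..].
Qed.

Lemma hull_add_y p q : nonneg q -> q.1 = 0 -> H p -> H (p + q).
Proof.
move=> [_ q0] q1; apply: hull_translate => {}p [xnat y0 xy].
apply: sub_conv_hull; split=> [j|j|].
- by rewrite /= q1 addr0.
- by rewrite !mxE addr_ge0.
- apply: le_trans xy _; apply: ler_sum => j _; rewrite /= q1 addr0 !mxE.
  by rewrite ler_wpM2l ?natr_ge0// lerDl.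
Qed.

(** Split the increment into its integral coordinates, one ray at a time, and
    its continuous part. *)
Lemma hull_upward p q : nonneg q -> H p -> H (p + q).
Proof.
move=> [q1 q2] Hp; have -> : q = \sum_i ray i (q.1 0 i) + (0, q.2).
  rewrite [LHS](surjective_pairing q); congr pair.
    rewrite [LHS]row_sum_delta/= addr0 (big_morph (@fst _ _) (id1 := 0) (op1 := +%R))//.
  by rewrite /= (big_morph (@snd _ _) (id1 := 0) (op1 := +%R))// big1 ?add0r.
rewrite addrA; apply: hull_add_y => //=; first by split=> i //=; rewrite mxE.
elim/big_rec: _ => [|i v _ Hv]; first by rewrite addr0.
by rewrite [_ + v]addrC addrA; apply: hull_add_ray.
Qed.

(** Membership in [l H] for [l > 0]; for [l = 0] the recession directions of [H]
    take the place of [0 H].  With this convention memberships add up without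
    dividing by a vanishing weight. *)
Definition gauge (l : R) p :=
  (l = 0 /\ nonneg p) \/ (0 < l /\ H (l^-1 *: p)).

Lemma nonnegZ t p : 0 <= t -> nonneg p -> nonneg (t *: p).
Proof. by move=> t0 [p1 p2]; split=> i /=; rewrite mxE mulr_ge0. Qed.

Lemma gaugeD l m p q : gauge l p -> gauge m q -> gauge (l + m) (p + q).
Proof.
move=> [[-> p0]|[l0 Hp]] [[-> q0]|[m0 Hq]].
- left; split; first by rewrite addr0.
  by case: p0 q0 => [? ?] [? ?]; split=> i; rewrite mxE addr_ge0.
- right; split; first by rewrite add0r.
  rewrite add0r scalerDr addrC; apply: hull_upward => //.
  by apply: nonnegZ => //; rewrite invr_ge0 ltW.
- right; split; first by rewrite addr0.
  rewrite addr0 scalerDr; apply: hull_upward => //.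
  by apply: nonnegZ => //; rewrite invr_ge0 ltW.
- have lm0 : 0 < l + m by rewrite addr_gt0.
  right; split=> //.
  have -> : (l + m)^-1 *: (p + q) =
      (l / (l + m)) *: (l^-1 *: p) + (1 - l / (l + m)) *: (m^-1 *: q).
    rewrite scalerDr !scalerA; congr (_ *: _ + _ *: _);
      field; rewrite !gt_eqF//.
  apply: conv_hull_convex => //; rewrite divr_ge0 ?(ltW l0) ?(ltW lm0)//=.
  by rewrite ler_pdivrMr// mul1r lerDl ltW.
Qed.

Lemma gauge_ge1 l p : 1 <= l -> nonneg p -> gauge l p -> H p.
Proof.
move=> l1 p0 [[l0 _]|[l0 Hp]]; first by move: l1; rewrite l0 ler10.
rewrite -[p]scale1r -(subrK l^-1 1) scalerDl addrC.
apply: hull_upward => //; apply: nonnegZ => //.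
by rewrite subr_ge0 invf_le1.
Qed.

Definition embed i (x y : R) : V := (x *: delta_mx 0 i, y *: delta_mx 0 i).

Lemma embed_mixed i (m : nat) (y : R) : 0 <= y -> r <= m%:R * y ->
  H (embed i m%:R y).
Proof.
move=> y0 my; apply: sub_conv_hull; split=> [j|j|] /=.
- by rewrite !mxE rpredM// rpred_nat.
- by rewrite !mxE mulr_ge0// ler0n.
- rewrite (bigD1 i)//= big1 ?addr0 ?mxE ?eqxx ?mulr1// => j ji.
  by rewrite !mxE eqxx (negPf ji) mulr0 mul0r.
Qed.

(** With [g] the value of the term, [(X, Y) = (x, y) / g] satisfies the [k]-th
    one-coordinate inequality with equality.  The hypothesis on [k] says that
    the ratio [X / Y] is between the ratios [(k - 1)^2 / r] and [k^2 / r] of the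
    vertices [(k - 1, r / (k - 1))] and [(k, r / k)] of that line, so [(X, Y)] is
    on the segment joining them.  For [k = 1] the line is [X = 1], and [(1, Y)]
    with [Y >= r] is a point of the set. *)
Lemma embed_gauge i (k : nat) (x y : R) : (0 < k)%N -> 0 <= x -> 0 < y ->
    k.-1%:R ^+ 2 * y <= x * r <= k%:R ^+ 2 * y ->
  gauge (coef_a R k * x + coef_b r k * y) (embed i x y).
Proof.
move=> k0 x0 y0 /andP[kx xk].
have /= := facet_term_ge0 k0 x0 (ltW y0).
set g := coef_a R k * x + _; rewrite le_eqVlt => /predU1P[<-|g0].
  have y_ge0 := ltW y0.
  by left; split=> //; split=> j; rewrite /= !mxE mulr_ge0 ?ler0n.
right; split=> //.
have gE : (2 * k%:R - 1) * r * g = r * x + k%:R * (k%:R - 1) * y.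
  rewrite /g facet_termE//; field; rewrite !gt_eqF//; exact: double_pred_gt0.
have -> : g^-1 *: embed i x y = embed i (x / g) (y / g).
  by rewrite /embed; congr pair; rewrite /= scalerA mulrC.
have X0 : 0 <= x / g by rewrite divr_ge0// ltW.
have Y0 : 0 < y / g by rewrite divr_gt0.
have {}kx : k.-1%:R ^+ 2 * (y / g) <= x / g * r.
  by rewrite mulrA [x / g * r]mulrAC ler_pM2r ?invr_gt0.
have {}xk : x / g * r <= k%:R ^+ 2 * (y / g).
  by rewrite mulrA [x / g * r]mulrAC ler_pM2r ?invr_gt0.
have {}gE : (2 * k%:R - 1) * r = r * (x / g) + k%:R * (k%:R - 1) * (y / g).
  by apply: (mulIf (lt0r_neq0 g0)); rewrite gE; field; rewrite gt_eqF.
move: (x / g) (y / g) X0 Y0 kx xk gE => {g g0} X Y X0 Y0 kX Xk line.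
case: k k0 kX Xk line => [//|[_|k _]] /=.
  rewrite expr1n !mul1r mulr1 subrr mul0r addr0 => _ rXY XE.
  have -> : X = 1%:R.
    apply: (mulfI (lt0r_neq0 r_gt0)); rewrite -XE; ring.
  apply: embed_mixed; first exact: ltW.
  rewrite mul1r; nra.
(* From here on the index is [c + 1], and the weights are read off from
   [c <= X <= c + 1]. *)
rewrite -[k.+2%:R]natr1; set c : R := k.+1%:R => kX Xk line.
have c1 : 1 <= c by rewrite ler1n.
have c0 : 0 < c by rewrite ltr0n.
have X_ge : c <= X.
  have : c * (2 * c + 1) * r <= X * (2 * c + 1) * r by nra.
  by rewrite ler_pM2r// ler_pM2r//; lra.
have X_le : X <= c + 1.
  have : X * (2 * c + 1) * r <= (c + 1) * (2 * c + 1) * r by nra.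
  by rewrite ler_pM2r// ler_pM2r//; lra.
have YE : Y = (c + 1 - X) * (r / c) + (1 - (c + 1 - X)) * (r / (c + 1)).
  have cc0 : 0 < (c + 1) * c by nra.
  apply: (mulfI (lt0r_neq0 cc0)).
  have -> : (c + 1) * c * Y = (2 * c + 1) * r - r * X by nra.
  field; apply/andP; split; apply: lt0r_neq0; lra.
have -> : embed i X Y = (c + 1 - X) *: embed i k.+1%:R (r / c) +
    (1 - (c + 1 - X)) *: embed i k.+2%:R (r / (c + 1)).
  rewrite YE /embed -[k.+2%:R]natr1 -/c.
  congr pair; rewrite /= !scalerA -scalerDl; congr (_ *: _); ring.
apply: conv_hull_convex; first lra.
  apply: embed_mixed; first by rewrite divr_ge0 ?ltW.
  by rewrite -/c mulrCA divff ?mulr1// gt_eqF.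
have c2 : 0 < c + 1 by lra.
apply: embed_mixed; first by rewrite divr_ge0 ?ltW.
by rewrite -[k.+2%:R]natr1 -/c mulrCA divff ?mulr1// gt_eqF.
Qed.

(** The point is the sum of its coordinate pairs, each of which is in the multiple
    of the hull given by its term, by [embed_gauge]; pairs with [y_i = 0] enter as
    recession directions with weight [0]. *)
Lemma hull_of_terms (k : 'I_n -> nat) p : nonneg p ->
    (forall i, 0 < p.2 0 i -> (0 < k i)%N /\
       (k i).-1%:R ^+ 2 * p.2 0 i <= p.1 0 i * r <= (k i)%:R ^+ 2 * p.2 0 i) ->
    1 <= \sum_(i | 0 < p.2 0 i)
           (coef_a R (k i) * p.1 0 i + coef_b r (k i) * p.2 0 i) ->
  H p.
Proof.
move=> p0 kP /gauge_ge1; apply=> //; rewrite big_mkcond/=.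
have pE : p = \sum_i embed i (p.1 0 i) (p.2 0 i).
  rewrite [LHS](surjective_pairing p) [RHS]surjective_pairing; congr pair; rewrite [LHS]row_sum_delta.
    by rewrite (big_morph (@fst _ _) (id1 := 0) (op1 := +%R)).
  by rewrite (big_morph (@snd _ _) (id1 := 0) (op1 := +%R)).
rewrite [X in gauge _ X]pE; apply: (big_ind2 gauge) => [|? ? ? ?|i _].
- by left; split=> //; split=> j; rewrite mxE.
- exact: gaugeD.
case: p0 => x0 y0; case: ifPn => [yi|_].
  by have [k0 kxy] := kP i yi; apply: embed_gauge.
by left; split=> //; split=> j; rewrite !mxE mulr_ge0 ?ler0n.
Qed.

End MixedSet.

(** * Bit lengths and the cost of expressions *)

Section Bitlen.
Implicit Types u v w : nat.

Lemma bitlen_gt0 v : 0 < bitlen v. Proof. by []. Qed.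

Lemma ltn_bitlen v : v < 2 ^ bitlen v.
Proof. exact: trunc_log_ltn. Qed.

Lemma bitlen_le v w : 0 < w -> (bitlen v <= w) = (v < 2 ^ w).
Proof.
move=> w0; apply/idP/idP => [vw|].
  by apply: leq_trans (ltn_bitlen v) _; rewrite leq_exp2l.
have [->|v0] := posnP v; first by rewrite /bitlen trunc_log0.
by move=> vw; rewrite -(ltn_exp2l (m := 2))// (leq_ltn_trans _ vw)// trunc_logP.
Qed.

Lemma leq_bitlen u v : u <= v -> bitlen u <= bitlen v.
Proof. by move=> uv; rewrite ltnS leq_trunc_log. Qed.

Lemma bitlenM u v : bitlen (u * v) <= bitlen u + bitlen v.
Proof.
rewrite bitlen_le ?addn_gt0// expnD.
by rewrite ltn_mul ?ltn_bitlen.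
Qed.

Lemma bitlenD u v w : bitlen u <= w -> bitlen v <= w -> bitlen (u + v) <= w.+1.
Proof.
have [->|w0] := posnP w; first by rewrite leqNgt bitlen_gt0.
rewrite !bitlen_le// expnS; lia.
Qed.

Lemma leq_bitlen_id v : bitlen v <= v.+1.
Proof. by rewrite bitlen_le// (ltn_trans (ltnSn v))// ltn_expl. Qed.

End Bitlen.

Section Cost.
Variables (W : nat) (m : memory).
Hypothesis mW : forall a, bitlen (m a) <= W.

(** The weight [c.+1] of a constant bounds its bit length, so that one size
    controls both the value and the cost of an expression. *)
Fixpoint esize (e : expr) : nat :=
  match e with
  | Const c => c.+1
  | Cell a => (esize a).+1
  | Bin _ e1 e2 => (esize e1 + esize e2).+1
  end.

Let W_gt0 : 0 < W. Proof. exact: leq_trans (mW 0). Qed.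

(** Sums and products have at most as many bits as their arguments together. *)
Lemma eval_bitlen e : bitlen (eval m e) <= esize e * W.
Proof.
elim: e => [c|a _|o e1 IH1 e2 IH2] /=.
- by apply: leq_trans (leq_bitlen_id c) _; rewrite leq_pmulr.
- by apply: leq_trans (mW _) _; rewrite leq_pmull.
have le1 u : u <= eval m e1 -> bitlen u <= (esize e1 + esize e2).+1 * W.
  by move=> /leq_bitlen ?; nia.
case: o => /=.
- have := @bitlenD (eval m e1) (eval m e2) ((esize e1 + esize e2) * W).
  by move=> h; apply: leq_trans (h _ _) _; nia.
- by apply: le1; rewrite leq_subr.
- by apply: leq_trans (bitlenM _ _) _; nia.
- by apply: le1; rewrite leq_div.
Qed.

Lemma expr_cost_le e : expr_cost m e <= 2 * esize e ^ 2 * W.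
Proof.
elim: e => [c|a IH|o e1 IH1 e2 IH2] /=.
- by apply: leq_trans (leq_bitlen_id c) _; nia.
- have := eval_bitlen a; have := mW (eval m a); nia.
- have := eval_bitlen e1; have := eval_bitlen e2; nia.
Qed.

End Cost.

(** * Total correctness with step counts *)

Section Runs.
Variables (s W : nat).
Implicit Types (c : cmd) (e : expr) (m : memory) (Q : memory -> Prop).

Definition bounded m := forall a, bitlen (m a) <= W.

(** An upper bound for the cost of one elementary step, a test or an assignment,
    involving expressions of size at most [s] in a memory of [W]-bit numbers.
    Times are counted in multiples of it. *)
Definition unit_cost := 6 * s ^ 2 * W.

(** Weakest precondition for termination within [k] elementary steps. *)
Definition runs c m k Q :=
  exists t m', [/\ exec c m t m', t <= k * unit_cost & Q m'].

Lemma runs_weaken c m k k' Q Q' : runs c m k Q -> k <= k' ->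
  (forall m', Q m' -> Q' m') -> runs c m k' Q'.
Proof.
move=> [t [m' [ex tk Qm']]] kk' QQ'; exists t, m'; split=> //; last exact: QQ'.
by apply: leq_trans tk _; rewrite leq_mul2r kk' orbT.
Qed.

(** An assignment evaluates two expressions, hence the factor [2]. *)
Lemma half_cost m e : bounded m -> esize e <= s ->
  2 * (expr_cost m e + bitlen (eval m e)) <= unit_cost.
Proof.
move=> mW es; have := expr_cost_le mW e; have := eval_bitlen mW e.
have : esize e * W <= s ^ 2 * W.
  rewrite leq_mul2r (leq_trans es) ?orbT//.
  by case: s es => [|s'] _ //; rewrite -mulnn leq_pmulr.
have : esize e ^ 2 * W <= s ^ 2 * W by rewrite leq_mul2r leq_sqr es orbT.
rewrite /unit_cost -!mulnA; lia.
Qed.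

Lemma test_cost_le m e : bounded m -> esize e <= s ->
  expr_cost m e + bitlen (eval m e) <= unit_cost.
Proof. by move=> mW es; have := half_cost mW es; lia. Qed.

Lemma runs_skip m Q : bounded m -> 0 < s -> Q m -> runs Skip m 1 Q.
Proof.
move=> mW s0 Qm; have W0 : 0 < W by exact: leq_trans (mW 0).
exists 1, m; split=> //; first exact: ExecSkip.
rewrite /unit_cost; nia.
Qed.

Lemma runs_assign a e m Q : bounded m -> esize a <= s -> esize e <= s ->
  Q (update m (eval m a) (eval m e)) -> runs (Assign a e) m 1 Q.
Proof.
move=> mW sa se Qm; have W0 : 0 < W by exact: leq_trans (mW 0).
eexists _, _; split; [exact: ExecAssign| |exact: Qm].
have := half_cost mW sa; have := half_cost mW se; lia.
Qed.

Lemma runs_seq c1 c2 m k1 k2 Q :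
  runs c1 m k1 (fun m' => runs c2 m' k2 Q) -> runs (Seq c1 c2) m (k1 + k2) Q.
Proof.
move=> [t1 [m1 [ex1 t1k [t2 [m2 [ex2 t2k Qm2]]]]]].
exists (t1 + t2), m2; split=> //; first exact: ExecSeq ex1 ex2.
by rewrite mulnDl leq_add.
Qed.

Lemma runs_if e c1 c2 m k Q : bounded m -> esize e <= s ->
  (eval m e != 0 -> runs c1 m k Q) -> (eval m e = 0 -> runs c2 m k Q) ->
  runs (If e c1 c2) m k.+1 Q.
Proof.
move=> mW es r1 r2; have tc := test_cost_le mW es.
have [e0|e0] := eqVneq (eval m e) 0.
  have [t [m' [ex tk Qm']]] := r2 e0.
  eexists _, m'; split; [exact: ExecIfFalse e0 ex| |exact: Qm'].
  by rewrite mulSn leq_add.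
have [t [m' [ex tk Qm']]] := r1 e0.
eexists _, m'; split; [exact: ExecIfTrue e0 ex| |exact: Qm'].
by rewrite mulSn leq_add.
Qed.

(** In the invariant [I j], the number [j] bounds the rounds still to come; each
    round costs [k] steps and one test. *)
Lemma runs_while (I : nat -> memory -> Prop) e c k Q :
    esize e <= s ->
    (forall j m, I j m -> bounded m) ->
    (forall j m, I j m -> eval m e = 0 -> Q m) ->
    (forall j m, I j m -> eval m e != 0 ->
       exists2 j', j = j'.+1 & runs c m k (I j')) ->
  forall j m, I j m -> runs (While e c) m (j * k.+1).+1 Q.
Proof.
move=> es Ibnd Iend Istep; elim=> [|j IH] m Im; have tc := test_cost_le (Ibnd _ _ Im) es;
  have [e0|e0] := eqVneq (eval m e) 0.
- eexists _, m; split; [exact: ExecWhileFalse|by rewrite mul1n|exact: Iend Im e0].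
- by have [] := Istep _ _ Im e0.
- eexists _, m; split; [exact: ExecWhileFalse| |exact: Iend Im e0].
  by rewrite mulSn (leq_trans tc)// leq_addr.
- have [_ [<-] [t1 [m1 [ex1 t1k Im1]]]] := Istep _ _ Im e0.
  have [t2 [m2 [ex2 t2k Qm2]]] := IH _ Im1.
  eexists _, m2; split; [exact: ExecWhileTrue e0 ex1 ex2| |exact: Qm2].
  have -> : (j.+1 * k.+1).+1 = 1 + k + (j * k.+1).+1 by lia.
  by rewrite 2!mulnDl mul1n !leq_add.
Qed.

End Runs.

(** * The minimizing index *)

Section CeilRoot.
Variables (A B : nat).

(** The disjunct [B == 0] makes the definition of [ceil_root] total. *)
Lemma ceil_root_ex : exists k, (B == 0) || (0 < k) && (A <= k ^ 2 * B).
Proof. by exists A.+1; case: (posnP B) => //= B0; nia. Qed.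

Definition ceil_root := ex_minn ceil_root_ex.

(** The exit condition of the bisection identifies its upper end. *)
Lemma ceil_root_unique lo : 0 < B -> A <= lo.+1 ^ 2 * B ->
  (lo == 0) || (lo ^ 2 * B < A) -> ceil_root = lo.+1.
Proof.
move=> B0 Ahi Alo; rewrite /ceil_root; case: ex_minnP => k.
rewrite gtn_eqF//= => /andP[k0 Ak] /(_ lo.+1); rewrite /= Ahi => /(_ isT) klo.
apply/eqP; rewrite eqn_leq klo/= ltnNge; apply/negP => kle.
have lo0 : (lo == 0) = false by lia.
move: Alo; rewrite lo0 ltnNge (leq_trans Ak)// leq_mul2r leq_sqr kle orbT//.
Qed.

Lemma ceil_rootP : 0 < B ->
  [/\ 0 < ceil_root, A <= ceil_root ^ 2 * B,
      ceil_root.-1 ^ 2 * B <= A & ceil_root <= A.+1].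
Proof.
move=> B0; rewrite /ceil_root; case: ex_minnP => k.
rewrite gtn_eqF//= => /andP[k0 Ak] kmin; split=> //.
  case: k k0 Ak kmin => // k _ _ /(_ k)/=.
  rewrite ltnn; case: (leqP A (k ^ 2 * B)) => [_|/ltnW//].
  by case: k => [|k /(_ isT)].
by apply: kmin; nia.
Qed.

End CeilRoot.

(** * The separation program *)

Section Program.

Local Notation "a [+] b" := (Bin Defs.Add a b) (at level 50, left associativity).
Local Notation "a [-] b" := (Bin Defs.Sub a b) (at level 50, left associativity).
Local Notation "a [*] b" := (Bin Defs.Mul a b) (at level 40, left associativity).
Local Notation "a [/] b" := (Bin Defs.Div a b) (at level 40, left associativity).
Local Notation "a <~ e" := (Assign a e) (at level 75).
Local Notation "c1 ;; c2" := (Seq c1 c2) (at level 76, right associativity).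

(** The input occupies the cells below [4 n + 3], where [n] is in cell [0], and
    the working registers follow it, so a register address is computed from
    cell [0].  The registers are used as follows: [0] is the loop counter [i];
    [1] and [2] are the numerator [N] and the denominator [D] of the sum; [3] and
    [4] are [A] and [B] in the condition [A <= k ^ 2 * B] on the index; [5] and
    [6] are the ends of the bisection interval; [7] is the denominator of the
    current term. *)
Definition dim := Cell (Const 0).
Definition reg_addr j := Const (3 + j) [+] Const 4 [*] dim.
Definition reg j := Cell (reg_addr j).
Definition pair_addr c e := Const c [+] Const 2 [*] e.

(** Differences of natural numbers are truncated at [0], which makes them tests
    for strict inequality. *)
Definition prog_bisect :=
  let mid := (reg 5 [+] reg 6) [/] Const 2 in
  While (reg 6 [-] reg 5 [-] Const 1)
    (If (reg 3 [-] mid [*] mid [*] reg 4)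
      (reg_addr 5 <~ mid)
      (reg_addr 6 <~ mid)).

(** The index found is stored in place of the numerator of [y_i]: this cell is
    nonzero exactly when an index has been stored, because indices are positive
    and the cell is left alone when [y_i = 0]. *)
Definition prog_term :=
  let xn := Cell (pair_addr 3 (reg 0)) in
  let xd := Cell (pair_addr 4 (reg 0)) in
  let yn := Cell (pair_addr 3 (dim [+] reg 0)) in
  let yd := Cell (pair_addr 4 (dim [+] reg 0)) in
  let rn := Cell (Const 1) in
  let rd := Cell (Const 2) in
  reg_addr 3 <~ xn [*] rn [*] yd ;;
  reg_addr 4 <~ yn [*] xd [*] rd ;;
  reg_addr 5 <~ Const 0 ;;
  reg_addr 6 <~ reg 3 [+] Const 1 ;;
  prog_bisect ;;
  reg_addr 7 <~ xd [*] yd [*] rn [*] (Const 2 [*] reg 6 [-] Const 1) ;;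
  reg_addr 1 <~ reg 1 [*] reg 7
    [+] (reg 3 [+] reg 6 [*] (reg 6 [-] Const 1) [*] reg 4) [*] reg 2 ;;
  reg_addr 2 <~ reg 2 [*] reg 7 ;;
  pair_addr 3 (dim [+] reg 0) <~ reg 6.

Definition prog_sum :=
  While (dim [-] reg 0)
    (If (Cell (pair_addr 3 (dim [+] reg 0))) prog_term Skip ;;
     reg_addr 0 <~ reg 0 [+] Const 1).

(** Cell [i + 1] is overwritten in round [i], when the data of [r] and of the
    coordinates stored there have been used: the data of [x_i] starts at cell
    [2 i + 3].  Cell [0] keeps [n] until the end, since the register addresses
    depend on it. *)
Definition prog_output :=
  While (dim [-] reg 0)
    (If (Cell (pair_addr 3 (dim [+] reg 0)))
      (Const 1 [+] reg 0 <~ Cell (pair_addr 3 (dim [+] reg 0)))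
      (Const 1 [+] reg 0 <~
         dim [*] reg 2 [*] Cell (pair_addr 3 (reg 0)) [+] Const 1) ;;
     reg_addr 0 <~ reg 0 [+] Const 1).

Definition prog_separate :=
  reg_addr 2 <~ Const 1 ;;
  prog_sum ;;
  If (reg 2 [-] reg 1)
    (reg_addr 0 <~ Const 0 ;; prog_output ;; Const 0 <~ Const 0)
    (Const 0 <~ Const 1).

Variable n : nat.

(** Memory as an input area [f] followed by a register file [s]: an update of a
    register becomes an update of an explicit list. *)
Definition mem (f : memory) (s : seq nat) : memory :=
  fun a => if a < 4 * n + 3 then f a else nth 0 s (a - (4 * n + 3)).

Lemma update_reg f s j v :
  update (mem f s) (3 + j + 4 * n) v = mem f (set_nth 0 s j v).
Proof.
apply/funext => a; rewrite /update /mem /= nth_set_nth /=.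
case: eqVneq => [->|aj].
  have -> : (3 + j + 4 * n < 4 * n + 3) = false by lia.
  have -> : 3 + j + 4 * n - (4 * n + 3) = j by lia.
  by rewrite eqxx.
by case: ltnP => // na; case: eqVneq => //; lia.
Qed.

Lemma update_input f s a v : a < 4 * n + 3 ->
  update (mem f s) a v = mem (update f a v) s.
Proof.
move=> an; apply/funext => b; rewrite /update /mem /=.
by case: eqVneq => // ->; rewrite an.
Qed.

Section Eval.
Variables (f : memory) (s : seq nat).
Hypothesis inp0 : f 0 = n.

Lemma eval_dim : eval (mem f s) dim = n.
Proof. by rewrite /= /mem addn3. Qed.

Lemma eval_reg_addr j : eval (mem f s) (reg_addr j) = 3 + j + 4 * n.
Proof. by rewrite -eval_dim. Qed.

Lemma eval_reg j : eval (mem f s) (reg j) = nth 0 s j.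
Proof.
rewrite -[LHS]/(mem f s (eval (mem f s) (reg_addr j))) eval_reg_addr /mem.
case: ltnP => [|_]; first lia.
by congr nth; lia.
Qed.

Lemma eval_pair_addr c e :
  eval (mem f s) (pair_addr c e) = c + 2 * eval (mem f s) e.
Proof. by []. Qed.

Lemma eval_input e : eval (mem f s) e < 4 * n + 3 ->
  eval (mem f s) (Cell e) = f (eval (mem f s) e).
Proof. by move=> en; rewrite [LHS]/= {1}/mem en. Qed.

Lemma eval_bin o e1 e2 : eval (mem f s) (Bin o e1 e2) =
  binop_val o (eval (mem f s) e1) (eval (mem f s) e2).
Proof. by []. Qed.

Lemma eval_const c : eval (mem f s) (Const c) = c. Proof. by []. Qed.

End Eval.

(** Exceeds the size of every expression of the program; the largest one updates
    the numerator of the sum. *)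
Definition max_esize := 200.

Variable W : nat.
Hypothesis W_gt0 : 0 < W.
Local Notation runs := (runs max_esize W).

Definition small f (s : seq nat) :=
  [/\ f 0 = n, forall a, bitlen (f a) <= W & all (fun v => bitlen v <= W) s].

Lemma small_bounded f s : small f s -> bounded W (mem f s).
Proof.
move=> [_ fW /(all_nthP 0) sW] a; rewrite /mem; case: ifP => // _.
by have [/sW//|sa] := ltnP (a - (4 * n + 3)) (size s); rewrite nth_default.
Qed.

Lemma runs_set j e f s v Q : small f s ->
    esize (reg_addr j) <= max_esize -> esize e <= max_esize ->
    eval (mem f s) e = v -> Q (mem f (set_nth 0 s j v)) ->
  runs (reg_addr j <~ e) (mem f s) 1 Q.
Proof.
move=> sfs sj se ev Qv; apply: runs_assign => //; first exact: small_bounded.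
by rewrite eval_reg_addr; [rewrite ev update_reg|case: sfs].
Qed.

(** The interval halves in each round, from length [A + 1], which is at most
    [2 ^ bitlen A].  The lower end may be [0] without satisfying the strict
    inequality, as the index has to be positive. *)
Lemma runs_bisect f i N D A B d : 0 < B ->
    small f [:: i; N; D; A; B; 0; A.+1; d] ->
  runs prog_bisect (mem f [:: i; N; D; A; B; 0; A.+1; d]) (bitlen A * 3).+1
    (fun m => exists2 lo, lo <= A.+1 &
       m = mem f [:: i; N; D; A; B; lo; ceil_root A B; d]).
Proof.
move=> B0 [inp0 fW /= /and5P[iW NW DW AW /and5P[BW W1 A1W dW _]]].
pose state lo hi := mem f [:: i; N; D; A; B; lo; hi; d].
pose I j m := exists lo hi, [/\ m = state lo hi, lo < hi <= A.+1 /\ hi - lo <= 2 ^ j,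
  A <= hi ^ 2 * B & (lo == 0) || (lo ^ 2 * B < A)].
have sm lo hi : lo <= A.+1 -> hi <= A.+1 ->
    small f [:: i; N; D; A; B; lo; hi; d].
  move=> /leq_bitlen lA /leq_bitlen hA; split=> //=.
  by rewrite iW NW DW AW BW dW (leq_trans lA)// (leq_trans hA).
apply: (@runs_while _ _ I) => //.
- by move=> j _ [lo [hi [-> [lohi _] _ _]]]; apply: small_bounded; apply: sm; lia.
- move=> j _ [lo [hi [-> [lohi _] Ahi Alo]]].
  rewrite /state !eval_bin !eval_reg//= => hi_lo.
  have hiE : hi = lo.+1 by lia.
  exists lo; first lia.
  by rewrite (ceil_root_unique B0 _ Alo) -hiE.
- move=> j _ [lo [hi [-> [lohi hj] Ahi Alo]]].
  rewrite /state !eval_bin !eval_reg//= => hi_lo.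
  case: j hj => [|j hj]; first by rewrite expn0; lia.
  exists j => //; rewrite expnS in hj.
  have midE : eval (state lo hi) ((reg 5 [+] reg 6) [/] Const 2) = (lo + hi) %/ 2.
    by rewrite /state !eval_bin !eval_reg.
  have sm' : small f [:: i; N; D; A; B; lo; hi; d] by apply: sm; lia.
  apply: runs_if => //; first exact: small_bounded.
    rewrite /state !(eval_bin, eval_reg)//= -/(state lo hi) => Amid.
    apply: runs_set midE _ => //=.
    exists ((lo + hi) %/ 2), hi; split=> //; first lia.
    by apply/orP; right; rewrite -mulnn; lia.
  rewrite /state !(eval_bin, eval_reg)//= -/(state lo hi) => Amid.
  apply: runs_set midE _ => //=.
  exists lo, ((lo + hi) %/ 2); split=> //; first lia.
  by rewrite -mulnn; lia.
- exists 0, A.+1; split=> //; last by nia.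
  by split; [rewrite /= leqnn | exact: ltn_bitlen].
Qed.

Lemma small_set f s j v : small f s -> bitlen v <= W -> small f (set_nth 0 s j v).
Proof.
move=> [inp0 fW /(all_nthP 0) sW] vW; split=> //; apply/(all_nthP 0) => k _.
rewrite nth_set_nth /=; case: eqVneq => // _.
by have [/sW//|sk] := ltnP k (size s); rewrite nth_default.
Qed.

Lemma runs_set_seq j e f s v c k Q : small f s ->
    esize (reg_addr j) <= max_esize -> esize e <= max_esize ->
    eval (mem f s) e = v -> bitlen v <= W ->
    (small f (set_nth 0 s j v) -> runs c (mem f (set_nth 0 s j v)) k Q) ->
  runs (reg_addr j <~ e ;; c) (mem f s) k.+1 Q.
Proof.
move=> sfs sj se ev vW rc; rewrite -add1n; apply: runs_seq.
by apply: runs_set ev _ => //; apply: rc; apply: small_set.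
Qed.

Section Input.
Variables (inp : memory) (L : nat).
Hypotheses (L_ge3 : 3 <= L) (n_leL : n <= L).
(* The numbers computed have at most [12 L^2 + 1] bits; the factor [20] leaves
   room for the lower-order terms. *)
Hypothesis W_large : 20 * L ^ 2 <= W.
Hypotheses (inp0 : inp 0 = n) (inpL : forall a, bitlen (inp a) <= L).
Hypothesis inp_end : forall a, 4 * n + 3 <= a -> inp a = 0.

Definition r_num := inp 1.
Definition r_den := inp 2.
Definition x_num i := inp (3 + 2 * i).
Definition x_den i := inp (4 + 2 * i).
Definition y_num i := inp (3 + 2 * (n + i)).
Definition y_den i := inp (4 + 2 * (n + i)).

Hypothesis x_den_gt0 : forall i, i < n -> 0 < x_den i.
Hypothesis r_den_gt0 : 0 < r_den.

(** [x_i r / y_i] is the fraction [ratio_num i / ratio_den i], and the term of the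
    index [k] is [ratio_num i + k (k - 1) ratio_den i] divided by
    [x_den i y_den i r_num (2 k - 1)]. *)
Definition ratio_num i := x_num i * r_num * y_den i.
Definition ratio_den i := y_num i * x_den i * r_den.
Definition best_index i := ceil_root (ratio_num i) (ratio_den i).
Definition term_num i :=
  ratio_num i + best_index i * (best_index i - 1) * ratio_den i.
Definition term_den i :=
  x_den i * y_den i * r_num * (2 * best_index i - 1).

Fixpoint sum_num_den i : nat * nat :=
  if i is i'.+1 then
    let: (N, D) := sum_num_den i' in
    if y_num i' == 0 then (N, D)
    else (N * term_den i' + term_num i' * D, D * term_den i')
  else (0, 1).

(** The input area after [i] rounds of the summation loop. *)
Fixpoint marked i : memory :=
  if i is i'.+1 then
    if y_num i' == 0 then marked i'
    else update (marked i') (3 + 2 * (n + i')) (best_index i')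
  else inp.

(** For [y_i = 0] the term of this index is at most
    [x_num i / (2 n D x_num i + 1)], hence at most [1 / (2 n D)]. *)
Definition out_index i :=
  if y_num i == 0 then n * (sum_num_den n).2 * x_num i + 1 else best_index i.

(** The input area after [i] rounds of the output loop. *)
Fixpoint written i : memory :=
  if i is i'.+1 then update (written i') i'.+1 (out_index i') else marked n.

Lemma ratio_den_gt0 i : i < n -> y_num i != 0 -> 0 < ratio_den i.
Proof.
move=> /x_den_gt0 xd0 y0.
by rewrite !muln_gt0 xd0 r_den_gt0 lt0n y0.
Qed.

Lemma marked_input i a : (forall j, j < i -> a != 3 + 2 * (n + j)) ->
  marked i a = inp a.
Proof.
elim: i => //= i IH ai; have {}IH := IH (fun j ji => ai j (ltnW ji)).
case: ifP => // _; rewrite /update /=; case: eqVneq => // aE.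
by have := ai i (ltnSn i); rewrite aE eqxx.
Qed.

Lemma marked_y i j : j < i ->
  marked i (3 + 2 * (n + j)) = if y_num j == 0 then 0 else best_index j.
Proof.
elim: i => //= i IH; rewrite ltnS leq_eqVlt => /predU1P[->|ji]; last first.
  case: ifP => _; first exact: IH.
  by rewrite /update /=; case: eqVneq => [|_]; [lia|exact: IH].
case: ifP => [/eqP y0|_]; last by rewrite /update /= eqxx.
by rewrite marked_input // => k ki; lia.
Qed.

Lemma bitlen_ratio_num i : bitlen (ratio_num i) <= 3 * L.
Proof.
have := bitlenM (x_num i * r_num) (y_den i); have := bitlenM (x_num i) r_num.
have := inpL (3 + 2 * i); have := inpL 1; have := inpL (4 + 2 * (n + i)).
rewrite /ratio_num -/(x_num i) -/r_num -/(y_den i); lia.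
Qed.

Lemma bitlen_ratio_den i : bitlen (ratio_den i) <= 3 * L.
Proof.
have := bitlenM (y_num i * x_den i) r_den; have := bitlenM (y_num i) (x_den i).
have := inpL (4 + 2 * i); have := inpL 2; have := inpL (3 + 2 * (n + i)).
rewrite /ratio_den -/(y_num i) -/r_den -/(x_den i); lia.
Qed.

Lemma bitlen_ratio_numS i : bitlen (ratio_num i).+1 <= 3 * L + 1.
Proof.
rewrite -addn1 [3 * L + 1]addn1; apply: bitlenD; first exact: bitlen_ratio_num.
by rewrite /bitlen trunc_log1; lia.
Qed.

Section Term.
Variable i : nat.
Hypotheses (i_lt : i < n) (yi : y_num i != 0).

Lemma bitlen_best_index : bitlen (best_index i) <= 3 * L + 1.
Proof.
apply: leq_trans (bitlen_ratio_numS i); apply: leq_bitlen.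
by have [] := ceil_rootP (ratio_num i) (ratio_den_gt0 i_lt yi).
Qed.

Lemma bitlen_term_num : bitlen (term_num i) <= 10 * L.
Proof.
have kL := bitlen_best_index; have aL := bitlen_ratio_num i; have bL := bitlen_ratio_den i.
have k1L : bitlen (best_index i - 1) <= 3 * L + 1.
  by apply: leq_trans (leq_bitlen _) kL; rewrite leq_subr.
have := bitlenM (best_index i * (best_index i - 1)) (ratio_den i).
have := bitlenM (best_index i) (best_index i - 1).
move=> h1 h2; apply: leq_trans (bitlenD (w := 9 * L + 2) _ _) _; lia.
Qed.

Lemma bitlen_term_den : bitlen (term_den i) <= 10 * L.
Proof.
have kL := bitlen_best_index.
have dL : bitlen (2 * best_index i - 1) <= 2 + (3 * L + 1).
  apply: leq_trans (leq_bitlen (leq_subr _ _)) _.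
  by apply: leq_trans (bitlenM _ _) _; rewrite leq_add.
have := bitlenM (x_den i * y_den i * r_num) (2 * best_index i - 1).
have := bitlenM (x_den i * y_den i) r_num; have := bitlenM (x_den i) (y_den i).
have := inpL (4 + 2 * i); have := inpL 1; have := inpL (4 + 2 * (n + i)).
rewrite /term_den -/(x_den i) -/r_num -/(y_den i); lia.
Qed.

End Term.

(** Each coordinate adds at most [10 L] bits to the denominator; the numerator
    gains one more bit from the addition, paid for by the slack of [2 L]. *)
Lemma bitlen_sum i : i <= n ->
  bitlen (sum_num_den i).1 <= 12 * (L * i) + 1 /\
  bitlen (sum_num_den i).2 <= 10 * (L * i) + 1.
Proof.
elim: i => [|i IH] i_lt /=; first by rewrite muln0 /bitlen trunc_log1.
have [] := IH (ltnW i_lt); case: (sum_num_den i) => N D /= NL DL.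
have -> : L * i.+1 = L * i + L by rewrite mulnS addnC.
case: eqVneq => [_|yi] /=; first lia.
have := bitlen_term_den i_lt yi; have := bitlen_term_num i_lt yi.
have := bitlenM N (term_den i); have := bitlenM D (term_den i).
have := bitlenM (term_num i) D => h1 h2 h3 h4 h5; split; last lia.
apply: leq_trans (bitlenD (w := 12 * (L * i) + 1 + 10 * L) _ _) _; lia.
Qed.

Lemma bitlen_marked i a : i <= n -> bitlen (marked i a) <= 3 * L + 1.
Proof.
elim: i => [|i IH] i_lt /=; first by have := inpL a; lia.
case: eqVneq => [_|yi]; first exact/IH/ltnW.
by rewrite /update /=; case: eqVneq => _; [exact: bitlen_best_index|exact/IH/ltnW].
Qed.

Lemma linear_le_W : 20 * L <= W.
Proof. by apply: leq_trans W_large; rewrite leq_mul2l -mulnn leq_pmull//; lia. Qed.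

Lemma sum_le_W i : i <= n ->
  bitlen (sum_num_den i).1 <= W /\ bitlen (sum_num_den i).2 <= W.
Proof.
move=> i_le; have [] := bitlen_sum i_le.
have : L * i <= L * L by rewrite leq_mul2l (leq_trans i_le) ?orbT.
have : 3 * L <= L * L by rewrite leq_mul2r L_ge3 orbT.
move: W_large; rewrite -mulnn; lia.
Qed.

Lemma small_marked i s : i <= n -> all (fun v => bitlen v <= W) s ->
  small (marked i) s.
Proof.
move=> i_le sW; split=> //; first by rewrite marked_input.
move=> a; apply: leq_trans (bitlen_marked a i_le) _.
by have := linear_le_W; lia.
Qed.

Lemma eval_x f s c i : f 0 = n -> nth 0 s 0 = i -> i < n -> c <= 4 ->
  eval (mem f s) (Cell (pair_addr c (reg 0))) = f (c + 2 * i).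
Proof.
move=> f00 si i_lt c4; rewrite eval_input eval_pair_addr eval_reg// si//; lia.
Qed.

Lemma eval_y f s c i : f 0 = n -> nth 0 s 0 = i -> i < n -> c <= 4 ->
  eval (mem f s) (Cell (pair_addr c (dim [+] reg 0))) = f (c + 2 * (n + i)).
Proof.
move=> f00 si i_lt c4.
by rewrite eval_input eval_pair_addr eval_bin eval_dim// eval_reg// si//=; lia.
Qed.

Lemma eval_r f s c : f 0 = n -> c <= 2 -> eval (mem f s) (Cell (Const c)) = f c.
Proof. by move=> f00 c2; rewrite eval_input//=; lia. Qed.

Lemma sum_num_denS i : y_num i != 0 ->
  sum_num_den i.+1 = ((sum_num_den i).1 * term_den i + term_num i * (sum_num_den i).2,
                      (sum_num_den i).2 * term_den i).
Proof. by move=> yi /=; case: (sum_num_den i) => N D; rewrite (negPf yi). Qed.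

Lemma markedS i : y_num i != 0 ->
  marked i.+1 = update (marked i) (3 + 2 * (n + i)) (best_index i).
Proof. by move=> yi /=; rewrite (negPf yi). Qed.

Lemma sum_num_den_skip i : y_num i = 0 -> sum_num_den i.+1 = sum_num_den i.
Proof. by move=> yi /=; rewrite yi; case: (sum_num_den i). Qed.

Lemma marked_skip i : y_num i = 0 -> marked i.+1 = marked i.
Proof. by move=> yi /=; rewrite yi. Qed.

Arguments marked : simpl never.
Arguments sum_num_den : simpl never.

Lemma runs_term i N D a b lo hi d : i < n -> y_num i != 0 ->
    (N, D) = sum_num_den i -> small (marked i) [:: i; N; D; a; b; lo; hi; d] ->
  runs prog_term (mem (marked i) [:: i; N; D; a; b; lo; hi; d])
    ((bitlen (ratio_num i) * 3).+1 + 4).+4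
    (fun m => exists a b lo hi d,
       let s := [:: i; (sum_num_den i.+1).1; (sum_num_den i.+1).2; a; b; lo; hi; d] in
       small (marked i.+1) s /\ m = mem (marked i.+1) s).
Proof.
move=> i_lt yi NDE sm0.
have f00 : marked i 0 = n by case: sm0.
have lW := linear_le_W.
have [NW DW] := sum_le_W i_lt.
have dL := bitlen_term_den i_lt yi.
have mx c : c \in [:: 3; 4] -> marked i (c + 2 * i) = inp (c + 2 * i).
  by rewrite !inE => c34; apply: marked_input => j ji; lia.
have my c : c \in [:: 3; 4] ->
    marked i (c + 2 * (n + i)) = inp (c + 2 * (n + i)).
  by rewrite !inE => c34; apply: marked_input => j ji; lia.
have mr c : c \in [:: 1; 2] -> marked i c = inp c.
  by rewrite !inE => c34; apply: marked_input => j ji; lia.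
apply: (runs_set_seq sm0 _ _ (v := ratio_num i)) => //.
- by rewrite !eval_bin (@eval_x _ _ _ i)// (@eval_y _ _ _ i)// eval_r//= mx// my// mr.
- by have := bitlen_ratio_num i; lia.
move=> {sm0}/= sm0; apply: (runs_set_seq sm0 _ _ (v := ratio_den i)) => //.
- by rewrite !eval_bin (@eval_x _ _ _ i)// (@eval_y _ _ _ i)// eval_r//= mx// my// mr.
- by have := bitlen_ratio_den i; lia.
move=> {sm0}/= sm0; apply: (runs_set_seq sm0 _ _ (v := 0)) => //.
move=> {sm0}/= sm0; apply: (runs_set_seq sm0 _ _ (v := (ratio_num i).+1)) => //.
- by rewrite eval_bin eval_reg//= addn1.
- by have := bitlen_ratio_numS i; lia.
move=> {sm0}/= sm0; apply: runs_seq.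
have bW := bitlen_best_index i_lt yi.
apply: runs_weaken (runs_bisect (ratio_den_gt0 i_lt yi) sm0) (leqnn _) _.
move=> _ [l lA ->]; rewrite -/(best_index i).
have {}sm0 : small (marked i) [:: i; N; D; ratio_num i; ratio_den i; l; best_index i; d].
  case: sm0 => s1 s2 /= /and5P[iW NW0 DW0 AW /and5P[BW _ A1W dW _]].
  split=> //=; rewrite iW NW0 DW0 AW BW dW (leq_trans (leq_bitlen lA))//= andbT.
  lia.
apply: (runs_set_seq sm0 _ _ (v := term_den i)) => //.
- rewrite !eval_bin (@eval_x _ _ _ i)// (@eval_y _ _ _ i)// eval_r// eval_reg//=.
  by rewrite mx// my// mr.
- by lia.
have S1 : (sum_num_den i.+1).1 = N * term_den i + term_num i * D.
  by rewrite sum_num_denS// -NDE.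
have S2 : (sum_num_den i.+1).2 = D * term_den i.
  by rewrite sum_num_denS// -NDE.
move=> {sm0}/= sm0; apply: (runs_set_seq sm0 _ _ (v := (sum_num_den i.+1).1)) => //.
  by rewrite !(eval_bin, eval_reg)// S1.
move=> {sm0}/= sm0; apply: (runs_set_seq sm0 _ _ (v := (sum_num_den i.+1).2)) => //.
  by rewrite !(eval_bin, eval_reg)// S2.
move=> {sm0}sm0; apply: runs_assign => //; first exact: small_bounded.
rewrite eval_pair_addr eval_bin eval_dim// !eval_reg//= update_input; last lia.
rewrite -markedS//; do 5!eexists; split; last reflexivity.
by apply: small_marked => //; case: sm0.
Qed.

Definition sum_state i m := exists a b lo hi d,
  let s := [:: i; (sum_num_den i).1; (sum_num_den i).2; a; b; lo; hi; d] in
  small (marked i) s /\ m = mem (marked i) s.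

Lemma bitlen_ltn_n i : i <= n -> bitlen i <= W.
Proof.
move=> i_le; have nL : bitlen n <= L by rewrite -inp0.
have := leq_bitlen i_le; have := linear_le_W; lia.
Qed.

(** Closes a round of both loops. *)
Lemma runs_incr i a b lo hi d f N D (Q : memory -> Prop) : i < n ->
    small f [:: i; N; D; a; b; lo; hi; d] ->
    (small f [:: i.+1; N; D; a; b; lo; hi; d] ->
      Q (mem f [:: i.+1; N; D; a; b; lo; hi; d])) ->
  runs (reg_addr 0 <~ reg 0 [+] Const 1) (mem f [:: i; N; D; a; b; lo; hi; d]) 1 Q.
Proof.
move=> i_lt sm QS; have f00 : f 0 = n by case: sm.
apply: (runs_set (v := i.+1)) => //; first by rewrite eval_bin eval_reg//= addn1.
by apply: QS; apply: (small_set 0 sm); apply: bitlen_ltn_n.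
Qed.

Lemma runs_sum m : sum_state 0 m ->
  runs prog_sum m (n * (9 * L + 12)).+1 (sum_state n).
Proof.
move=> m0; pose I j m := exists2 i, i + j = n & sum_state i m.
have : I n m by exists 0.
rewrite (_ : 9 * L + 12 = (9 * L + 10 + 1).+1); last lia.
apply: (runs_while (I := I)) => // {m m0}.
- by move=> j m [i ij [a [b [lo [hi [d [sm ->]]]]]]]; apply: small_bounded.
- move=> j m [i ij mi]; have [a [b [lo [hi [d [sm mE]]]]]] := mi.
  have f00 : marked i 0 = n by case: sm.
  rewrite mE eval_bin eval_dim// eval_reg//= => i_end.
  by rewrite -mE; have -> : n = i by lia.
move=> j m [i ij mi]; have [a [b [lo [hi [d [sm mE]]]]]] := mi.
have f00 : marked i 0 = n by case: sm.
rewrite {1}mE eval_bin eval_dim// eval_reg//= => i_lt.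
have {}i_lt : i < n by lia.
exists j.-1; first lia.
have next m' : sum_state i.+1 m' -> I j.-1 m' by exists i.+1 => //; lia.
have guard : eval m (Cell (pair_addr 3 (dim [+] reg 0))) = y_num i.
  rewrite mE (eval_y (i := i))// marked_input// => k ki; lia.
apply: runs_seq.
have sW := small_bounded sm.
rewrite (_ : 9 * L + 10 = (9 * L + 9).+1); last lia.
apply: runs_if => //; rewrite ?mE//; rewrite -mE guard => yi.
  rewrite mE; apply: runs_weaken (runs_term i_lt yi _ sm) _ _.
  - by case: (sum_num_den i).
  - by have := bitlen_ratio_num i; lia.
  move=> _ [a' [b' [lo' [hi' [d' [sm' ->]]]]]].
  have {}sm' : small (marked i.+1) [:: i; (sum_num_den i.+1).1;
    (sum_num_den i.+1).2; a'; b'; lo'; hi'; d'] by [].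
  apply: runs_incr => // smS; apply: next.
  by exists a', b', lo', hi', d'.
apply: (@runs_weaken _ _ _ _ 1) => [||m' Qm']; [|lia|exact: Qm'].
rewrite mE; apply: runs_skip => //.
apply: runs_incr => // smS; apply: next.
by exists a, b, lo, hi, d; rewrite sum_num_den_skip// marked_skip.
Qed.

Lemma written_input i a : i < a -> written i a = marked n a.
Proof.
elim: i => //= i IH ia; rewrite /update /=.
by case: eqVneq => [aE|_]; [lia|apply: IH; lia].
Qed.

Lemma written_out i j : j < i -> written i j.+1 = out_index j.
Proof.
elim: i => //= i IH; rewrite ltnS leq_eqVlt => /predU1P[->|ji]; rewrite /update /=.
  by rewrite eqxx.
by case: eqVneq => [|_]; [lia|exact: IH].
Qed.

Lemma written0 i : written i 0 = n.
Proof. by elim: i => [|i IH] /=; rewrite ?marked_input. Qed.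

Lemma bitlen_out i : i < n -> bitlen (out_index i) <= W.
Proof.
move=> i_lt; rewrite /out_index; have lW := linear_le_W.
case: eqVneq => [_|yi]; last by have := bitlen_best_index i_lt yi; lia.
have [_] := bitlen_sum (leqnn n).
have : L * n <= L * L by rewrite leq_mul2l n_leL orbT.
have L3 : 3 * L <= L * L by rewrite leq_mul2r L_ge3 orbT.
have := bitlenM n (sum_num_den n).2.
have := bitlenM (n * (sum_num_den n).2) (x_num i).
have : bitlen n <= L by rewrite -inp0.
have := inpL (3 + 2 * i); rewrite -/(x_num i); move: W_large; rewrite -mulnn.
move=> h1 h2 h3 h4 h5 h6 h7.
apply: leq_trans (bitlenD (w := 10 * (L * L) + 1 + 2 * L) _ _) _; try lia.
by rewrite /bitlen trunc_log1; lia.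
Qed.

Definition output_state i m := exists a b lo hi d N,
  let s := [:: i; N; (sum_num_den n).2; a; b; lo; hi; d] in
  small (written i) s /\ m = mem (written i) s.

Lemma runs_output m : output_state 0 m ->
  runs prog_output m (n * 4).+1 (output_state n).
Proof.
move=> m0; pose I j m := exists2 i, i + j = n & output_state i m.
have : I n m by exists 0.
apply: (@runs_while _ _ I _ _ (2 + 1)) => // {m m0}.
- by move=> j m [i ij [a [b [lo [hi [d [N [sm ->]]]]]]]]; apply: small_bounded.
- move=> j m [i ij mi]; have [a [b [lo [hi [d [N [sm mE]]]]]]] := mi.
  rewrite mE eval_bin eval_dim ?eval_reg ?written0//= => i_end.
  by rewrite -mE; have -> : n = i by lia.
move=> j m [i ij [a [b [lo [hi [d [N [sm ->]]]]]]]] {m}.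
have f00 : written i 0 = n by exact: written0.
rewrite eval_bin eval_dim// eval_reg//= => i_lt.
have {}i_lt : i < n by lia.
exists j.-1; first lia.
have next m' : output_state i.+1 m' -> I j.-1 m' by exists i.+1 => //; lia.
have sW := small_bounded sm.
set s := [:: i; _; _; _; _; _; _; _] in sm sW *.
have yE : eval (mem (written i) s) (Cell (pair_addr 3 (dim [+] reg 0))) =
    if y_num i == 0 then 0 else best_index i.
  by rewrite (eval_y (i := i))// written_input ?marked_y//; lia.
have xE : eval (mem (written i) s) (Cell (pair_addr 3 (reg 0))) = x_num i.
  rewrite (eval_x (i := i))// written_input; last lia.
  by rewrite marked_input// => k ki; lia.
have best_gt0 : y_num i != 0 -> best_index i != 0.
  by move=> yi; rewrite -lt0n; have [] := ceil_rootP (ratio_num i) (ratio_den_gt0 i_lt yi).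
have out_runs e : esize e <= max_esize -> eval (mem (written i) s) e = out_index i ->
    runs (Const 1 [+] reg 0 <~ e) (mem (written i) s) 1 (fun m =>
      runs (reg_addr 0 <~ reg 0 [+] Const 1) m 1 (I j.-1)).
  move=> e_small eE; apply: runs_assign => //.
  rewrite eE eval_bin eval_const eval_reg//= add1n update_input; last lia.
  apply: runs_incr => // [|smS].
    case: sm => [_ fW sW']; split=> //=.
    by move=> c; rewrite /update /=; case: eqP => // _; apply: bitlen_out.
  by apply: next; exists a, b, lo, hi, d, N.
apply: runs_seq; apply: runs_if => //.
  rewrite yE; case: (eqVneq (y_num i)) => // yi _; apply: out_runs => //.
  by rewrite yE /out_index (negPf yi).
rewrite yE; case: (eqVneq (y_num i)) => [yi _|/best_gt0/eqP//].
apply: out_runs => //.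
by rewrite !eval_bin eval_dim// eval_reg// xE /= /out_index yi.
Qed.

(** The bisection of each of the [n] coordinates takes at most [9 L + 1] steps;
    the rest of a round has a fixed number of steps. *)
Lemma runs_separate : runs prog_separate inp (n * (9 * L + 16) + 7) (fun m =>
  let: (N, D) := sum_num_den n in
  if D <= N then m 0 = 1
  else m 0 = 0 /\ forall i, i < n -> m i.+1 = out_index i).
Proof.
have inpE : inp = mem inp (nseq 8 0).
  apply/funext => a; rewrite /mem nth_nseq if_same; case: ltnP => // /inp_end//.
have sm0 : small (marked 0) (nseq 8 0) by apply: small_marked => //=; rewrite W_gt0.
rewrite {1}inpE -[inp]/(marked 0).
rewrite (_ : _ + 7 = ((n * (9 * L + 12)).+1 + (n * 4 + 4).+1).+1); last lia.
apply: (runs_set_seq sm0 _ _ (v := 1)) => // sm1.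
apply: runs_seq; apply: runs_weaken (runs_sum _) (leqnn _) _.
  by exists 0, 0, 0, 0, 0.
move=> m [a [b [lo [hi [d [sm ->]]]]]].
case E : (sum_num_den n) sm => [N D] /= sm.
have f00 : marked n 0 = n by case: sm.
have sW := small_bounded sm.
apply: runs_if => //; rewrite !(eval_bin, eval_reg)//= => DN; last first.
  apply: (@runs_weaken _ _ _ _ 1) => [||m' Qm']; [|lia|exact: Qm'].
  apply: runs_assign => //; have -> : D <= N by lia.
  by [].
have -> : (D <= N) = false by lia.
rewrite (_ : n * 4 + 4 = ((n * 4).+1 + 2).+1); last lia.
apply: (runs_set_seq sm _ _ (v := 0)) => // smo.
apply: runs_seq; apply: runs_weaken (runs_output _) (leqnn _) _.
  by exists a, b, lo, hi, d, N; rewrite E.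
move=> m' [a' [b' [lo' [hi' [d' [N' [sm' ->]]]]]]].
apply: (@runs_weaken _ _ _ _ 1) => [||m'' Qm'']; [|lia|exact: Qm''].
apply: runs_assign => //; first exact: small_bounded.
rewrite /update /=; split=> // i i_lt.
rewrite /mem; have -> : i.+1 < 4 * n + 3 by lia.
exact: written_out.
Qed.

End Input.

End Program.

Arguments sum_num_den : simpl never.

(** * Correctness of the computed answer *)

Section Correctness.
Local Open Scope ring_scope.
Variables (R : realType) (n : nat) (inp : memory).
Hypothesis n_gt0 : (0 < n)%N.
Hypotheses (r_num_gt0 : (0 < r_num inp)%N) (r_den_gt0 : (0 < r_den inp)%N).
Hypothesis x_den_gt0 : forall i, (i < n)%N -> (0 < x_den inp i)%N.
Hypothesis y_den_gt0 : forall i, (i < n)%N -> (0 < y_den n inp i)%N.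

Definition real_r : R := (r_num inp)%:R / (r_den inp)%:R.
Definition real_x i : R := (x_num inp i)%:R / (x_den inp i)%:R.
Definition real_y i : R := (y_num n inp i)%:R / (y_den n inp i)%:R.
Definition real_point : 'rV[R]_n * 'rV[R]_n :=
  (\row_i real_x i, \row_i real_y i).

Lemma real_r_gt0 : 0 < real_r.
Proof. by rewrite divr_gt0 ?ltr0n. Qed.

Lemma real_y_gt0 (i : 'I_n) : (0 < real_y i) = (y_num n inp i != 0%N).
Proof. by rewrite -lt0n pmulr_lgt0 ?ltr0n// invr_gt0 ltr0n y_den_gt0. Qed.

Lemma best_indexP i : (i < n)%N -> y_num n inp i != 0%N ->
  [/\ (0 < best_index n inp i)%N,
      (best_index n inp i).-1%:R ^+ 2 * real_y i <= real_x i * real_r &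
      real_x i * real_r <= (best_index n inp i)%:R ^+ 2 * real_y i].
Proof.
move=> i_lt yi.
have [k0 ub lb _] := ceil_rootP (ratio_num n inp i) (ratio_den_gt0 x_den_gt0 r_den_gt0 i_lt yi).
have xd0 : 0 < (x_den inp i)%:R :> R by rewrite ltr0n x_den_gt0.
have yd0 : 0 < (y_den n inp i)%:R :> R by rewrite ltr0n y_den_gt0.
have rd0 : 0 < (r_den inp)%:R :> R by rewrite ltr0n.
pose d : R := (x_den inp i)%:R * (y_den n inp i)%:R * (r_den inp)%:R.
have d0 : 0 < d by rewrite !mulr_gt0.
have -> : real_x i * real_r = (ratio_num n inp i)%:R / d.
  by rewrite /real_x /real_r /ratio_num /d !natrM; field; rewrite !gt_eqF.
have -> : real_y i = (ratio_den n inp i)%:R / d.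
  by rewrite /real_y /ratio_den /d !natrM; field; rewrite !gt_eqF.
split=> //; rewrite mulrA ler_pM2r ?invr_gt0// -natrX -natrM ler_nat; [exact: lb|exact: ub].
Qed.

Local Notation term k i := (coef_a R k * real_x i + coef_b real_r k * real_y i).

Lemma term_den_gt0 i : (i < n)%N -> y_num n inp i != 0%N ->
  (0 < term_den n inp i)%N.
Proof.
move=> i_lt yi; have [k0 _ _] := best_indexP i_lt yi.
by rewrite /term_den !muln_gt0 x_den_gt0// y_den_gt0// r_num_gt0/=; lia.
Qed.

Lemma best_termE i : (i < n)%N -> y_num n inp i != 0%N ->
  term (best_index n inp i) i = (term_num n inp i)%:R / (term_den n inp i)%:R.
Proof.
move=> i_lt yi; have [k0 _ _] := best_indexP i_lt yi.
have xd0 : 0 < (x_den inp i)%:R :> R by rewrite ltr0n x_den_gt0.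
have yd0 : 0 < (y_den n inp i)%:R :> R by rewrite ltr0n y_den_gt0.
have rd0 : 0 < (r_den inp)%:R :> R by rewrite ltr0n.
have rn0 : 0 < (r_num inp)%:R :> R by rewrite ltr0n.
have k1 := double_pred_gt0 R k0.
rewrite facet_termE ?real_r_gt0// /term_num /term_den /ratio_num /ratio_den.
rewrite /real_x /real_y /real_r natrD !natrM !natrB//; last lia.
rewrite natrM; field; rewrite !gt_eqF//=.
Qed.

(** The denominator stays positive, so the computed fraction is the partial sum
    of the minimal terms. *)
Lemma sum_num_denE i : (i <= n)%N ->
  (0 < (sum_num_den n inp i).2)%N /\
  (sum_num_den n inp i).1%:R / (sum_num_den n inp i).2%:R =
    \sum_(0 <= j < i | y_num n inp j != 0%N) term (best_index n inp j) j.
Proof.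
elim: i => [|i IH] i_lt; first by rewrite big_geq//= mul0r.
have [D0 sE] := IH (ltnW i_lt).
rewrite big_mkcond big_nat_recr//= -big_mkcond -sE.
have [y0|yi] := eqVneq (y_num n inp i) 0%N.
  by rewrite sum_num_den_skip// addr0.
have := term_den_gt0 i_lt yi; rewrite sum_num_denS// best_termE//=.
case: (sum_num_den n inp i) D0 {IH sE} => N D /=.
move: (term_num _ _ _) (term_den _ _ _) => p q D0 q0.
split; first by rewrite muln_gt0 D0.
by rewrite natrD !natrM; field; rewrite !pnatr_eq0 -!lt0n D0 q0.
Qed.

Let N := (sum_num_den n inp n).1.
Let D := (sum_num_den n inp n).2.

Lemma best_sumE :
  (0 < D)%N /\ N%:R / D%:R =
   \sum_(i < n | y_num n inp i != 0%N) term (best_index n inp i) i.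
Proof. by have [D0 ->] := sum_num_denE (leqnn n); rewrite big_mkord. Qed.

Lemma member_of_large_sum : (D <= N)%N ->
  conv_hull (@mixed_set R n real_r) real_point.
Proof.
move=> DN; have [D0 sE] := best_sumE.
have row (F : nat -> R) (i : 'I_n) : (\row_j F j) 0 i = F i by rewrite mxE.
apply: (hull_of_terms real_r_gt0 (k := fun i => best_index n inp i)).
- by split=> i; rewrite row divr_ge0.
- move=> i; rewrite /real_point /= !row real_y_gt0 => yi.
  by have [k0 -> ->] := best_indexP (ltn_ord i) yi.
have -> : \sum_(i < n | 0 < real_point.2 0 i)
    (coef_a R (best_index n inp i) * real_point.1 0 i +
     coef_b real_r (best_index n inp i) * real_point.2 0 i) = N%:R / D%:R.
  rewrite sE; apply: eq_big => [i|i _]; first by rewrite row real_y_gt0.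
  by rewrite !row.
by rewrite ler_pdivlMr ?ltr0n// mul1r ler_nat.
Qed.

Lemma out_index_gt0 i : (i < n)%N -> (0 < out_index n inp i)%N.
Proof.
rewrite /out_index => i_lt; case: eqVneq => [_|yi]; first by rewrite addn1.
by have [] := best_indexP i_lt yi.
Qed.

(** Since [N] and [D] are integers, [N < D] leaves a gap of [1 / D] below [1].  The
    coordinates with [y_i = 0] fill at most half of it: there are at most [n] of
    them, each contributing at most [1 / (2 n D)]. *)
Lemma violated_of_small_sum : (N < D)%N ->
  ~ facet_ineq real_r (fun i : 'I_n => out_index n inp i) real_point.
Proof.
move=> ND; have [D0 sE] := best_sumE.
have nR : 0 < n%:R :> R by rewrite ltr0n.
have DR : 0 < D%:R :> R by rewrite ltr0n.
pose e : R := (2 * n%:R * D%:R)^-1.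
have e0 : 0 < e by rewrite invr_gt0 !mulr_gt0.
rewrite /facet_ineq; apply/negP; rewrite -ltNge.
have row (F : nat -> R) (i : 'I_n) : (\row_j F j) 0 i = F i by rewrite mxE.
rewrite (eq_bigr (fun i : 'I_n => term (out_index n inp i) i)); last first.
  by move=> i _; rewrite !row.
rewrite (bigID (fun i : 'I_n => y_num n inp i != 0%N))/=.
rewrite (eq_bigr (fun i : 'I_n => term (best_index n inp i) i)); last first.
  by move=> i yi; rewrite /out_index (negPf yi).
rewrite -sE.
have rest : \sum_(i < n | ~~ (y_num n inp i != 0%N)) term (out_index n inp i) i
    <= n%:R * e.
  rewrite -[n in n%:R]card_ord mulr_natl -sumr_const big_mkcond/=.
  apply: ler_sum => i _; case: ifP => [|_]; last exact: ltW.
  rewrite negbK => /eqP yi; rewrite /out_index yi eqxx /real_y yi !mul0r mulr0 addr0.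
  have xd1 : 1 <= (x_den inp i)%:R :> R by rewrite ler1n x_den_gt0.
  have xn0 : 0 <= (x_num inp i)%:R :> R by rewrite ler0n.
  have x_le : real_x i <= (x_num inp i)%:R.
    by rewrite ler_pdivrMr ?ler_peMr//; lra.
  have x_ge0 : 0 <= real_x i by rewrite divr_ge0.
  rewrite /coef_a natrD !natrM -/D /e.
  set X := (x_num inp i)%:R in xn0 x_le *.
  have nD0 : 0 < n%:R * D%:R :> R by rewrite mulr_gt0.
  have nDX0 : 0 <= n%:R * D%:R * X by rewrite mulr_ge0// ltW.
  rewrite ler_pdivrMl; last lra.
  rewrite -mulrA ler_pdivlMr; last lra.
  nra.
have ne : n%:R * e = (2 * D%:R)^-1 by rewrite /e; field; rewrite !gt_eqF.
apply: le_lt_trans (_ : _ <= (N%:R + 2^-1) / D%:R) _.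
  rewrite mulrDl lerD2l -invfM -ne; exact: rest.
rewrite ltr_pdivrMr// mul1r; have : N%:R + 1 <= D%:R :> R by rewrite natr1 ler_nat.
lra.
Qed.

End Correctness.

(** * Encoding of instances *)

Section Encoding.
Local Open Scope ring_scope.

Lemma nth_flatten_pairs (T : Type) (g h : T -> nat) (s : seq T) k :
  (nth 0 (flatten [seq [:: g i; h i] | i <- s]) (2 * k) = nth 0 (map g s) k)%N /\
  (nth 0 (flatten [seq [:: g i; h i] | i <- s]) (2 * k).+1 = nth 0 (map h s) k)%N.
Proof.
by elim: s k => [|i s IH] [|k]; rewrite ?mulnS ?add2n //; apply: IH.
Qed.

Lemma nth_map_ord_enum n (g : 'I_n -> nat) (i : 'I_n) :
  nth 0%N [seq g j | j <- enum 'I_n] i = g i.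
Proof. by rewrite (nth_map i) ?size_enum_ord// nth_ord_enum. Qed.

Lemma size_flatten_pairs (T : Type) (g h : T -> nat) (s : seq T) :
  size (flatten [seq [:: g i; h i] | i <- s]) = (2 * size s)%N.
Proof. by elim: s => //= i s ->; rewrite mulnS. Qed.

Lemma bitlen_le_encoding (w : seq nat) v : v \in w ->
  (bitlen v <= encoding_length w)%N.
Proof.
move=> vw; rewrite /encoding_length (big_rem v)//=; exact: leq_addr.
Qed.

Lemma size_le_encoding (w : seq nat) : (size w <= encoding_length w)%N.
Proof.
by rewrite /encoding_length -sum1_size leq_sum.
Qed.

Lemma ratr_ge0E (R : realType) (q : rat) : 0 <= q ->
  ratr q = `|numq q|%N%:R / `|denq q|%N%:R :> R.
Proof.
rewrite -numq_ge0 => q0.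
by rewrite /ratr -{1}(gez0_abs q0) -{1}(gez0_abs (denq_ge0 q)).
Qed.

Variables (n : nat) (r : rat) (x y : 'rV[rat]_n).
Let inp := input_memory (instance_code r x y).
Let xs := flatten [seq rat_code (x ord0 i) | i <- enum 'I_n].
Let ys := flatten [seq rat_code (y ord0 i) | i <- enum 'I_n].

Lemma instance_size : size (instance_code r x y) = (4 * n + 3)%N.
Proof.
rewrite /= size_cat !size_flatten_pairs size_enum_ord; lia.
Qed.

Lemma instance_x (i : 'I_n) :
  x_num inp i = `|numq (x ord0 i)|%N /\ x_den inp i = `|denq (x ord0 i)|%N.
Proof.
have ltx : (2 * i < 2 * n)%N by rewrite ltn_mul2l/=.
have ltx1 : ((2 * i).+1 < 2 * n)%N by have := ltn_ord i; lia.
rewrite -[x_num inp i]/(nth 0%N (xs ++ ys) (2 * i)%N).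
rewrite -[x_den inp i]/(nth 0%N (xs ++ ys) (2 * i).+1).
rewrite !nth_cat !size_flatten_pairs size_enum_ord ltx ltx1.
have [-> ->] := nth_flatten_pairs (fun j => `|numq (x ord0 j)|%N)
  (fun j => `|denq (x ord0 j)|%N) (enum 'I_n) i.
by rewrite !nth_map_ord_enum.
Qed.

Lemma instance_y (i : 'I_n) :
  y_num n inp i = `|numq (y ord0 i)|%N /\ y_den n inp i = `|denq (y ord0 i)|%N.
Proof.
have ltx : (2 * (n + i) < 2 * n)%N = false by lia.
have ltx1 : ((2 * (n + i)).+1 < 2 * n)%N = false by lia.
rewrite -[y_num n inp i]/(nth 0%N (xs ++ ys) (2 * (n + i))%N).
rewrite -[y_den n inp i]/(nth 0%N (xs ++ ys) (2 * (n + i)).+1).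
rewrite !nth_cat !size_flatten_pairs size_enum_ord ltx ltx1.
have -> : (2 * (n + i) - 2 * n = 2 * i)%N by lia.
have -> : ((2 * (n + i)).+1 - 2 * n = (2 * i).+1)%N by lia.
have [-> ->] := nth_flatten_pairs (fun j => `|numq (y ord0 j)|%N)
  (fun j => `|denq (y ord0 j)|%N) (enum 'I_n) i.
by rewrite !nth_map_ord_enum.
Qed.

Lemma bitlen_instance a :
  (bitlen (inp a) <= encoding_length (instance_code r x y))%N.
Proof.
have [a_lt|a_ge] := ltnP a (size (instance_code r x y)).
  by apply: bitlen_le_encoding; apply: mem_nth.
rewrite /inp /input_memory nth_default//.
by apply: leq_trans (size_le_encoding _); rewrite instance_size addn3.
Qed.

End Encoding.

Theorem proposition6 (R : realType) :
  exists (prog : cmd) (c d : nat),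
    forall (n : nat) (r : rat) (x y : 'rV[rat]_n),
      (0 < n)%N -> (0 < r)%R ->
      (forall i, (0 <= x ord0 i)%R) -> (forall i, (0 <= y ord0 i)%R) ->
      exists (t : nat) (m : memory),
        [/\ exec prog (input_memory (instance_code r x y)) t m,
            (t <= c * encoding_length (instance_code r x y) ^ d)%N
          & separation_answer R r x y m].
Proof.
exists prog_separate, (20 * (6 * max_esize ^ 2 * 20))%N, 4 => n r x y n0 r0 x0 y0.
set inp := input_memory _; set L := encoding_length _.
have nL : (4 * n + 3 <= L)%N.
  by rewrite -(instance_size r x y); exact: size_le_encoding.
have absden (q : rat) : (0 < `|denq q|)%N by rewrite absz_gt0 denq_eq0.
have rn0 : (0 < r_num inp)%N by rewrite absz_gt0 numq_eq0 gt_eqF.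
have rd0 : (0 < r_den inp)%N by exact: absden.
have xd0 i : (i < n)%N -> (0 < x_den inp i)%N.
  by move=> i_lt; have [_ ->] := instance_x r x y (Ordinal i_lt).
have yd0 i : (i < n)%N -> (0 < y_den n inp i)%N.
  by move=> i_lt; have [_ ->] := instance_y r x y (Ordinal i_lt).
have rE : ratr r = real_r R inp by rewrite ratr_ge0E// ltW.
have pE : rat_point R x y = real_point R n inp.
  congr pair; apply/rowP => i; rewrite !mxE ratr_ge0E//.
    by have [<- <-] := instance_x r x y i.
  by have [<- <-] := instance_y r x y i.
have [||||||t [m [ex t_le]]] :=
  @runs_separate n (20 * L ^ 2) _ inp L _ _ (leqnn _) _ _ _ xd0 rd0.
- by rewrite muln_gt0 expn_gt0; lia.
- by lia.
- by lia.
- by [].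
- exact: bitlen_instance.
- by move=> a a_ge; rewrite /inp /input_memory nth_default// instance_size.
move=> answer; exists t, m; split=> //.
  apply: leq_trans t_le _; rewrite /unit_cost.
  have nLL : (n * L <= L * L)%N by rewrite leq_mul2r; lia.
  have LL : (7 * L <= L * L)%N by rewrite leq_mul2r; lia.
  have L3 : (n * (9 * L + 16) + 7 <= 20 * L ^ 2)%N by rewrite -mulnn; lia.
  (* At most [20 L^2] steps, each costing a constant times [20 L^2]. *)
  rewrite (expnD L 2 2).
  move: (max_esize ^ 2)%N (L ^ 2)%N L3 => M q L3.
  have := leq_mul L3 (leqnn (6 * M * 20 * q)); lia.
rewrite /separation_answer /= rE pE.
have member := @member_of_large_sum R n inp.
have violated := @violated_of_small_sum R n inp n0.
case: sum_num_den member violated answer => N D /= member violated.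
have [DN m0|ND [m0 mi]] := leqP D N; first by left; split=> //; exact: member.
have mE : (fun i : 'I_n => m i.+1) = fun i : 'I_n => out_index n inp i.
  by apply/funext => i; rewrite mi.
have k0 (i : 'I_n) : (0 < m i.+1)%N by rewrite mi// out_index_gt0.
have valid p : conv_hull (@mixed_set R n (real_r R inp)) p ->
    facet_ineq (real_r R inp) (fun i : 'I_n => m i.+1) p.
  by apply: facet_valid => //; apply: real_r_gt0.
have viol : ~ facet_ineq (real_r R inp) (fun i : 'I_n => m i.+1) (real_point R n inp).
  by rewrite mE; exact: violated.
by right; split=> // /valid.
Qed.
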